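(* For every $C_0>0$ there exist functions $W=W_{C_0},V=V_{C_0}:\mathbb{R}\to\mathbb{C}$ with $$\sup_{x\in\mathbb{R}}|\partial_x^nW(x)|+\sup_{x\in\mathbb{R}}|\partial_x^nV(x)|\le C_0^n,\qquad\forall n\in\mathbb{N}_0,$$ and a solution $u=u_{C_0}\in L^\infty(\mathbb{R})$ of $\partial_x^2u=W(x)\partial_xu+V(x)u$ on $\mathbb{R}$ with $\|u\|_{L^\infty(\mathbb{R})}=1$, such that there is an absolute constant $K>0$ (independent of $C_0$ and $\kappa$) for which, for any $\kappa>1$, $$\|\partial_x^nu\|_{L^\infty(\mathbb{R})}\le\left(\kappa C_0+K\left(\frac1{\log\kappa}+1\right)\right)^n\frac{n!}{\log^n(n+e)},\qquad\forall n\in\mathbb{N}_0,$$ and such that the following statements hold. (1) For every $C>0$ and $\lambda>1$ (and every $C_0>0$), the solution $u=u_{C_0}$ does not satisfy $$\|\partial_x^nu\|_{L^\infty(\mathbb{R})}\le\frac{C^nn!}{\log^{\lambda n}(n+e)},\qquad\forall n\in\mathbb{N}_0 .$$ (2) For every $0<\kappa<1$ and $C>0$, there is a threshold such that for all $C_0$ larger than this threshold the solution $u=u_{C_0}$ does not satisfy $$\|\partial_x^nu\|_{L^\infty(\mathbb{R})}\le(\kappa C_0+C)^n\frac{n!}{\log^n(n+e)},\qquad\forall n\in\mathbb{N}_0 .$$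
   Context: $\mathbb{N}_0=\{0,1,2,\dots\}$; $\log$ is the natural logarithm, $\log^{s}(y)=(\log y)^s$. Functions are complex-valued. *)

(* Defs.v *)
From HB Require Import structures.
From mathcomp Require Import all_boot all_order all_algebra.
From mathcomp Require Import all_classical all_reals all_analysis.
From mathcomp Require Import complex.

Set Implicit Arguments.
Unset Strict Implicit.
Unset Printing Implicit Defensive.

Import Order.TTheory GRing.Theory Num.Theory numFieldNormedType.Exports.
Local Open Scope ring_scope.
Local Open Scope classical_set_scope.

(* [Rcomplex R] is the field R[i] seen as an R-vector space, with the modulus
   as R-valued norm. Only the topology is missing for it to be a normed module
   over R, and thereby a codomain for the derivatives [f^`(n)] of functions of a
   real variable. *)
Section Rcomplex_normedModType.
Variable R : realType.

Lemma Rcomplex_normrZ (l : R) (z : Rcomplex R) : `|l *: z| = `|l| * `|z|.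
Proof.
case: z => a b; rewrite /Num.norm/=.
by rewrite !exprMn -mulrDr sqrtrM ?sqr_ge0// sqrtr_sqr.
Qed.

HB.instance Definition _ :=
  PseudoMetric.copy (Rcomplex R) (pseudoMetric_normed (Rcomplex R)).
HB.instance Definition _ := isPointed.Build (Rcomplex R) 0.
HB.instance Definition _ :=
  NormedZmod_PseudoMetric_eq.Build R (Rcomplex R) erefl.
HB.instance Definition _ :=
  PseudoMetricNormedZmod_Lmodule_isNormedModule.Build R (Rcomplex R)
    Rcomplex_normrZ.

End Rcomplex_normedModType.

Section complex_valued_functions.
Variable R : realType.
Implicit Types f : R -> Rcomplex R.

Definition smooth f := forall (n : nat) (x : R), derivable (f^`(n)) x 1.

Definition sup_norm f : \bar R := ereal_sup (range (fun x => `|f x|%:E)).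

Definition Linfty_norm f : \bar R :=
  Lnorm (@lebesgue_measure R) +oo%E (fun x => `|f x|%:E).

Definition log_ne (n : nat) : R := ln (n%:R + expR 1).

End complex_valued_functions.

(* Main.v *)
Require Import Defs.
From mathcomp Require Import all_boot all_order all_algebra.
From mathcomp Require Import all_classical all_reals all_analysis.
From mathcomp Require Import complex.
From mathcomp Require Import measurable_realfun ess_sup_inf ring lra zify.

Import Order.TTheory GRing.Theory Num.Theory numFieldNormedType.Exports.
Local Open Scope ring_scope.
Local Open Scope classical_set_scope.
Set Implicit Arguments.
Unset Strict Implicit.
Unset Printing Implicit Defensive.

(** Put [a = 1 / (C0 (1 + C0))] and [E x = exp (i C0 x)].  The solution is
    [u = exp (a (E - 1))]: since [u' = i C0 a E u], it satisfies
    [u'' = W u' + V u] with [W = i C0 a E] and [V = - C0^2 a E].  Both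
    coefficients are pure oscillations of frequency [C0], so the suprema of their
    [n]-th derivatives add up to [C0^n a C0 (1 + C0) = C0^n], which is what fixes
    the value of [a].

    Write [h_j = (a E)^j u] ([mode]).  Then [h_j' = i C0 (j h_j + h_(j+1))], and
    this is the recurrence of the Stirling numbers [S(n, j)] of the second kind:
    [u^(n) = (i C0)^n sum_j S(n, j) h_j].  All the modes are maximal in modulus,
    and positive, at [x = 0].  Hence the norm of [u^(n)] is exactly
    [C0^n T_n(a)], where [T_n(a) = sum_j S(n, j) a^j] is the Touchard polynomial
    ([Linfty_mode_sum]), that is, the [n]-th moment of a Poisson variable of
    parameter [a].  What remains is to compare [T_n(a)] with
    [n! / log^n (n + e)].

    Both comparisons come from Dobinski's formula
    [exp a * T_n(a) = sum_k k^n a^k / k!].  Bounding [(r k)^n / n!] by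
    [exp (r k)] in every term gives
    [T_n(a) <= n! r^(-n) exp (a (exp r - 1))] for every [r > 0]
    ([touchard_le]); with [r = log (n + e)] if [C0 >= 1] and
    [r = C0 log (n + e)] if [C0 < 1], the exponential costs at most a factor
    [(1 + O(1/C0))^n], respectively [O(1)^n], so that [C0 + K] can replace
    [kappa C0 + K (1 / log kappa + 1)] ([touchard_upper]).  Conversely, the
    single term [k ~ exp m], with [n = k m], shows that for each [q < 1] one has
    [T_n(a) > n! (q / log (n + e))^n] for suitable arbitrarily large [n]
    ([touchard_lower]).  Taking [q = 1/2] refutes (1), because
    [log^lambda] eventually exceeds any multiple of [log]; taking
    [q = kappa + C / C0], which is below [1] once [C0 > C / (1 - kappa)],
    refutes (2). *)

(** * Derivatives of complex exponentials *)

Section complex_derivatives.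
Variable R : realType.
Implicit Types (c z : Rcomplex R) (x : R).

Lemma Rcomplex_normM c z : `|c * z : Rcomplex R| = `|c| * `|z|.
Proof. exact: Normc.normcM. Qed.

Lemma Rcomplex_normX z n : `|z ^+ n : Rcomplex R| = `|z| ^+ n.
Proof.
elim: n => [|n IH]; first by rewrite !expr0; exact: Normc.normc1.
by rewrite !exprS Rcomplex_normM IH.
Qed.

(** Multiplication by [c] is continuous because the modulus is multiplicative. *)
Lemma is_derive_mull c (f : R -> Rcomplex R) x df :
  is_derive x 1 f df ->
  is_derive x 1 (fun t => c * f t : Rcomplex R) (c * df : Rcomplex R).
Proof.
case=> fx <-.
have cf : h^-1 *: (c * f (h *: 1 + x) - c * f x : Rcomplex R) @[h --> 0^']
    --> (c * 'D_1 f x : Rcomplex R).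
  have -> : (fun h : R => h^-1 *: (c * f (h *: 1 + x) - c * f x : Rcomplex R)) =
            (fun h => c * (h^-1 *: (f (h *: 1 + x) - f x)) : Rcomplex R).
    apply/funext => h; rewrite -mulrBr [RHS]mulrC -scalerAl; congr (_ *: _).
    exact: mulrC.
  apply/cvgrPdist_le => e e0.
  have e1 : 0 < e / (`|c| + 1) by rewrite divr_gt0// ltr_wpDl.
  have /cvgrPdist_le/(_ _ e1) : h^-1 *: (f (h *: 1 + x) - f x) @[h --> 0^']
    --> 'D_1 f x by exact: fx.
  apply: filterS => h; rewrite -mulrBr Rcomplex_normM.
  rewrite ler_pdivlMr ?ltr_wpDl// => /(le_trans _); apply.
  by rewrite mulrC ler_wpM2l// lerDl.
by apply: DeriveDef; [apply/cvg_ex; exists (c * 'D_1 f x)|exact: cvg_lim].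
Qed.

(** Keeps the type [Rcomplex R]: on a bare [(s +i* t)%C] the ring operations
    and the norm would be those of [R[i]], whose norm is complex-valued. *)
Definition rect (s t : R) : Rcomplex R := (s +i* t)%C.

Lemma rect_natl j z : rect j%:R 0 * z = z *+ j.
Proof.
elim: j => [|j IH]; first by rewrite mulr0n -[rect _ _]/(0 : Rcomplex R) mul0r.
have -> : rect j.+1%:R 0 = rect j%:R 0 + 1.
  by apply/eqP; rewrite eq_complex /= -natr1 addr0 !eqxx.
by rewrite mulrDl mul1r mulrSr IH.
Qed.

(** The difference quotient splits as a real combination of [1] and [i], and
    scaling a fixed vector is continuous. *)
Lemma is_derive_rect (g h : R -> R) x dg dh :
  is_derive x 1 g dg -> is_derive x 1 h dh ->
  is_derive x 1 (fun t => rect (g t) (h t)) (rect dg dh).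
Proof.
case=> gx <- [hx <-].
have E (s t : R) :
    rect s t = s *: (1 : Rcomplex R) + t *: ('i%C : Rcomplex R).
  by apply/eqP; rewrite eq_complex /= !mulr0 !mulr1 addr0 add0r !eqxx.
set F := fun t => rect (g t) (h t).
have cf : t^-1 *: (F (t *: 1 + x) - F x) @[t --> 0^'] -->
    rect ('D_1 g x) ('D_1 h x).
  rewrite E.
  have -> : (fun t : R => t^-1 *: (F (t *: 1 + x) - F x)) =
    (fun t => (t^-1 *: (g (t *: 1 + x) - g x)) *: (1 : Rcomplex R)
            + (t^-1 *: (h (t *: 1 + x) - h x)) *: ('i%C : Rcomplex R)).
    by apply/funext => t; rewrite -E; apply/eqP; rewrite eq_complex/= !eqxx.
  by apply: cvgD; apply: cvgZr_tmp; [exact: gx|exact: hx].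
by apply: DeriveDef; [apply/cvg_ex; exists (rect ('D_1 g x) ('D_1 h x))|
                      exact: cvg_lim].
Qed.

(** The complex exponential of [r + i t], in polar form. *)
Definition cexp (r t : R) : Rcomplex R := rect (expR r * cos t) (expR r * sin t).

Lemma cexpD r r' t t' : cexp (r + r') (t + t') = cexp r t * cexp r' t'.
Proof.
apply/eqP; rewrite eq_complex /= expRD cosD sinD.
by apply/andP; split; apply/eqP; ring.
Qed.

Lemma norm_cexp r t : `|cexp r t| = expR r.
Proof.
transitivity (Num.sqrt ((expR r * cos t) ^+ 2 + (expR r * sin t) ^+ 2)) => //.
by rewrite !exprMn -mulrDr cos2Dsin2 mulr1 sqrtr_sqr ger0_norm// expR_ge0.
Qed.

Lemma is_derive_cexp (f g : R -> R) x df dg :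
  is_derive x 1 f df -> is_derive x 1 g dg ->
  is_derive x 1 (fun s => cexp (f s) (g s))
    (rect df dg * cexp (f x) (g x) : Rcomplex R).
Proof.
move=> fx gx.
have ef : is_derive x 1 (fun s => expR (f s)) (df * expR (f x)).
  by rewrite mulrC -[_ * _]/(_ *: _); exact: is_derive1_comp.
have cg : is_derive x 1 (fun s => cos (g s)) (- sin (g x) * dg).
  by exact: is_derive1_comp.
have sg : is_derive x 1 (fun s => sin (g s)) (cos (g x) * dg).
  by exact: is_derive1_comp.
have -> : (rect df dg * cexp (f x) (g x) : Rcomplex R) =
    rect (expR (f x) *: (- sin (g x) * dg) + cos (g x) *: (df * expR (f x)))
      (expR (f x) *: (cos (g x) * dg) + sin (g x) *: (df * expR (f x))).
  apply/eqP; rewrite eq_complex /=.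
  by apply/andP; split; apply/eqP; rewrite /GRing.scale/=; ring.
by apply: is_derive_rect; exact: is_deriveM.
Qed.

(** Iterated derivatives are computed by guessing all of them at once. *)
Lemma derive1n_is_derive (F : nat -> R -> Rcomplex R) :
  (forall n x, is_derive x 1 (F n) (F n.+1 x)) ->
  forall n, (F 0%N)^`(n) = F n.
Proof.
move=> dF; elim=> [//|n IH]; rewrite derive1nS IH; apply/funext => x.
by rewrite derive1E; case: (dF n x).
Qed.

End complex_derivatives.

(** * Stirling numbers and the modes of the solution *)

Fixpoint stirling2 n j : nat :=
  match n, j with
  | 0, 0 => 1
  | 0, _.+1 => 0
  | _.+1, 0 => 0
  | n.+1, j.+1 => stirling2 n j + j.+1 * stirling2 n j.+1
  end.

Lemma stirling2_small n j : (n < j)%N -> stirling2 n j = 0%N.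
Proof.
by elim: n j => [|n IH] [|j]//= nj; rewrite !IH ?muln0// ltnW.
Qed.

(** The recurrence of the Stirling numbers, transposed: the map sending [h_j] to
    [j h_j + h_(j+1)] advances [n] by one.  It is used once for the derivatives
    of the modes and once for the powers [k^n]. *)
Lemma sum_stirling2S (V : nmodType) (h : nat -> V) n :
  \sum_(j < n.+2) h j *+ stirling2 n.+1 j =
  \sum_(j < n.+1) (h j *+ j + h j.+1) *+ stirling2 n j.
Proof.
under [RHS]eq_bigr do rewrite mulrnDl -mulrnA.
rewrite big_split [RHS]/= [RHS]addrC [LHS]big_ord_recl mulr0n add0r.
under [LHS]eq_bigr => j _ do rewrite lift0 /= mulrnDr.
rewrite big_split [LHS]/=; congr (_ + _).
transitivity (\sum_(j < n.+2) h j *+ (j * stirling2 n j)).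
  by rewrite [RHS]big_ord_recl mul0n mulr0n add0r.
by rewrite big_ord_recr/= stirling2_small// muln0 mulr0n addr0.
Qed.

Section modes.
Variables (R : realType) (al C : R).
Local Notation k := (rect 0 C).
Local Notation a := (expR al).

(** [a exp (i C x)] with [a = exp al]; parametrising by [al] keeps every
    function below a complex exponential. *)
Definition wave x : Rcomplex R := cexp al (C * x).

(** [wave ^ j * exp (wave - a)]; the solution is [mode 0]. *)
Definition mode j x : Rcomplex R :=
  cexp (j%:R * al + a * (cos (C * x) - 1)) (j%:R * (C * x) + a * sin (C * x)).

Lemma modeS j x : mode j.+1 x = wave x * mode j x.
Proof. by rewrite /mode /wave -cexpD; congr cexp; rewrite -natr1; ring. Qed.

Let is_deriveCx (x : R) : is_derive x 1 (fun s => C * s) C.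
Proof. by rewrite -[X in is_derive _ _ _ X]mulr1; exact: is_deriveZ. Qed.

Lemma is_derive_wave (x : R) : is_derive x 1 wave (k * wave x).
Proof. by apply: is_derive_cexp; exact: is_deriveCx. Qed.

Lemma is_derive_mode j (x : R) :
  is_derive x 1 (mode j) (k * (mode j x *+ j + mode j.+1 x)).
Proof.
have dc : is_derive x 1 (fun s => j%:R * al + a * (cos (C * s) - 1))
    (- (a * C * sin (C * x))).
  have dcos : is_derive x 1 (fun s => cos (C * s)) (- sin (C * x) * C).
    by apply: (is_derive1_comp (f := cos)) => //; exact: is_deriveCx.
  have -> : - (a * C * sin (C * x)) = 0 + a *: (- sin (C * x) * C - 0).
    by rewrite /GRing.scale/=; ring.
  by apply: is_deriveD; apply: is_deriveZ; apply: is_deriveB.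
have ds : is_derive x 1 (fun s => j%:R * (C * s) + a * sin (C * s))
    (j%:R * C + a * C * cos (C * x)).
  have dsin : is_derive x 1 (fun s => sin (C * s)) (cos (C * x) * C).
    by apply: (is_derive1_comp (f := sin)) => //; exact: is_deriveCx.
  have -> : j%:R * C + a * C * cos (C * x) = j%:R *: C + a *: (cos (C * x) * C).
    by rewrite /GRing.scale/=; ring.
  by apply: is_deriveD; apply: is_deriveZ => //; exact: is_deriveCx.
have := is_derive_cexp dc ds.
congr (is_derive _ _ _ _).
rewrite modeS -[mode j x]/(cexp _ _) -rect_natl -mulrDl [RHS]mulrA; congr (_ * _).
by apply/eqP; rewrite eq_complex /=; apply/andP; split; apply/eqP; ring.
Qed.

(** The [n]-th derivative of [mode 0]. *)
Definition mode_sum n x : Rcomplex R :=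
  k ^+ n * \sum_(j < n.+1) mode j x *+ stirling2 n j.

Lemma is_derive_mode_sum n (x : R) : is_derive x 1 (mode_sum n) (mode_sum n.+1 x).
Proof.
rewrite /mode_sum (sum_stirling2S (mode ^~ x)) exprSr -mulrA.
apply: is_derive_mull.
rewrite mulr_sumr.
have -> : (fun t => \sum_(j < n.+1) mode j t *+ stirling2 n j) =
  \sum_(j < n.+1) (fun t => mode j t *+ stirling2 n j).
  by apply/funext => t; rewrite fct_sumE.
apply: is_derive_sum => j.
rewrite mulrnAr.
have := is_deriveZ (stirling2 n j)%:R (is_derive_mode j x).
rewrite scaler_nat; congr (is_derive _ _ _ _).
by apply/funext => t; rewrite /= scaler_nat.
Qed.

End modes.

(** * Norms of the derivatives *)

Section norms.
Variable R : realType.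

(** If the essential supremum were smaller than the value at the maximum point
    [x0], then by continuity a whole ball around [x0] would be negligible. *)
Lemma Linfty_norm_max (f : R -> Rcomplex R) (x0 : R) :
  {for x0, continuous f} -> (forall x, `|f x| <= `|f x0|) ->
  Linfty_norm f = `|f x0|%:E.
Proof.
move=> fc fmax; rewrite /Linfty_norm unlock.
have mupos (x e : R) : 0 < e -> (0 < @lebesgue_measure R (ball x e))%E.
  by move=> e0; rewrite lebesgue_measure_ball ?ltW// lte_fin mulrn_wgt0.
have mu0 : (0 < @lebesgue_measure R [set: R])%E.
  by apply: (lt_le_trans (mupos 0 1 ltr01)); apply: le_measure; rewrite ?inE//;
    [exact: measurable_ball].
rewrite mu0; apply/eqP; rewrite eq_le; apply/andP; split.
  by apply/ess_supP; apply: nearW => x /=; rewrite lee_fin normr_id.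
rewrite leNgt; apply/negP => lts.
set S := ess_sup _ _ in lts.
have : \forall x \ae lebesgue_measure, ((abse \o (fun y => `|f y|%:E)) x <= S)%E by exact: ess_sup_ge.
have nearS : \forall x \near x0, (S < `|f x|%:E)%E.
  have fn : `|f x| @[x --> x0] --> `|f x0| by exact: (cvg_norm fc).
  move: lts; case: S => [s|//|].
  - rewrite lte_fin => lts.
    have sf : \forall x \near x0, s < `|f x| by exact: (cvgr_gt _ fn).
    by apply: filterS sf => x; rewrite lte_fin.
  - by move=> _; apply: (@nearW _ (nbhs x0)) => x; rewrite ltNyr.
have [e /= e0 eS] := nearS.
rewrite /almost_everywhere/= => neg.
have : lebesgue_measure.-negligible (ball x0 e).
  apply: negligibleS neg => x /eS /= + /=.
  by rewrite ltNge normr_id => /negP.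
move=> nb; have b0 : lebesgue_measure (ball x0 e) = 0%E.
  by apply: measure_negligible nb; exact: measurable_ball.
by have := mupos x0 e e0; rewrite b0 ltxx.
Qed.

End norms.

Definition touchard (R : realType) n (a : R) : R :=
  \sum_(j < n.+1) a ^+ j *+ stirling2 n j.

Lemma touchard_ge0 (R : realType) n (a : R) : 0 <= a -> 0 <= touchard n a.
Proof. by move=> a0; apply: sumr_ge0 => j _; rewrite mulrn_wge0// exprn_ge0. Qed.

Section mode_norms.
Variables (R : realType) (al C : R).
Hypothesis C0 : 0 < C.

Lemma norm_rect_re (s : R) : 0 <= s -> `|rect s 0| = s.
Proof.
move=> s0; transitivity (Num.sqrt (s ^+ 2 + 0 ^+ 2)) => //.
by rewrite expr0n addr0 sqrtr_sqr ger0_norm.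
Qed.

Lemma norm_rect_im : `|rect 0 C| = C.
Proof.
transitivity (Num.sqrt (0 ^+ 2 + C ^+ 2)) => //.
by rewrite expr0n add0r sqrtr_sqr gtr0_norm.
Qed.

Lemma norm_wave x : `|wave al C x| = expR al.
Proof. exact: norm_cexp. Qed.

Lemma norm_mode_le j x : `|mode al C j x| <= expR al ^+ j.
Proof.
rewrite norm_cexp -expRM_natl ler_expR gerDl.
by rewrite mulr_ge0_le0// ?expR_ge0// subr_le0 cos_le1.
Qed.

Lemma mode_at0 j : mode al C j 0 = rect (expR al ^+ j) 0.
Proof.
rewrite /mode !mulr0 cos0 sin0 subrr !mulr0 !addr0 /cexp expRM_natl.
by rewrite cos0 sin0 mulr1 mulr0.
Qed.

Lemma norm_mode_sum_le n x :
  `|mode_sum al C n x| <= C ^+ n * touchard n (expR al).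
Proof.
rewrite Rcomplex_normM Rcomplex_normX norm_rect_im ler_pM2l ?exprn_gt0//.
apply: le_trans (ler_norm_sum _ _ _) _; apply: ler_sum => j _.
by rewrite normrMn lerMn2r norm_mode_le orbT.
Qed.

(** At [0] every mode is the positive real [a ^ j], so the triangle inequality
    in [norm_mode_sum_le] is an equality there. *)
Lemma norm_mode_sum0 n :
  `|mode_sum al C n 0| = C ^+ n * touchard n (expR al).
Proof.
rewrite Rcomplex_normM Rcomplex_normX norm_rect_im; congr (_ * _).
rewrite -[RHS]norm_rect_re ?touchard_ge0 ?expR_ge0//; congr (`|_|).
rewrite /touchard; elim/big_ind2 : _ => // [z1 s z2 t -> -> |j _].
  by apply/eqP; rewrite eq_complex /= addr0 !eqxx.
rewrite mode_at0; elim: (stirling2 _ _) => [|m IH]; first by rewrite !mulr0n.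
by rewrite !mulrSr IH; apply/eqP; rewrite eq_complex /= addr0 !eqxx.
Qed.

Lemma Linfty_mode_sum n :
  Linfty_norm (mode_sum al C n) = (C ^+ n * touchard n (expR al))%:E.
Proof.
rewrite (@Linfty_norm_max _ _ 0) ?norm_mode_sum0//; last first.
  exact: norm_mode_sum_le.
have [df _] := is_derive_mode_sum al C n 0.
by apply: differentiable_continuous; exact/derivable1_diffP.
Qed.

End mode_norms.

(** * Dobinski bounds on Touchard polynomials *)

Section touchard_bounds.
Variable R : realType.
Implicit Types (a r : R) (n k : nat).

(** [a^k / k!] times the falling factorial [k (k - 1) ... (k - j + 1)]; the
    conditional makes it vanish for [j > k]. *)
Let shifted_term a k j : R := if (j <= k)%N then a ^+ k / (k - j)`!%:R else 0.

(** The expansion of [k^n] into falling factorials: multiplying the [j]-th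
    falling factorial by [k] gives [j] times itself plus the next one. *)
Lemma pow_stirling2 a n k :
  k%:R ^+ n * (a ^+ k / k`!%:R) = \sum_(j < n.+1) shifted_term a k j *+ stirling2 n j.
Proof.
elim: n => [|n IH].
  by rewrite big_ord_recl big_ord0 /= /shifted_term /= subn0 expr0 mul1r addr0.
rewrite sum_stirling2S exprS -mulrA IH mulr_sumr; apply: eq_bigr => j _.
rewrite mulrnAr; congr (_ *+ _); rewrite /shifted_term.
have [jk|kj|->] := ltngtP j k.
- have -> : (k - j)%N = (k - j.+1).+1 by lia.
  rewrite factS natrM.
  have -> : (k - j.+1).+1%:R = k%:R - j%:R :> R.
    by rewrite -natrB ?(ltnW jk)//; congr _%:R; lia.
  have f0 : (k - j.+1)`!%:R != 0 :> R by rewrite pnatr_eq0 -lt0n fact_gt0.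
  have kj0 : k%:R - j%:R != 0 :> R by rewrite subr_eq0 eqr_nat gtn_eqF.
  rewrite -mulr_natr; field.
  by rewrite f0 kj0.
- by rewrite mul0rn addr0 mulr0.
- by rewrite addr0 mulr_natl.
Qed.

Lemma exp_term_le a n : 0 <= a -> a ^+ n / n`!%:R <= expR a.
Proof.
move=> a0; case: n => [|n].
  by rewrite expr0 divr1 -[leLHS]expR0 ler_expR.
by apply: le_trans (expR_ge1Dxn n a0); rewrite lerDr.
Qed.

(** One term of Dobinski's series is at most its sum. *)
Lemma touchard_ge a n k : 0 <= a ->
  k%:R ^+ n * (a ^+ k / k`!%:R) <= expR a * touchard n a.
Proof.
move=> a0; rewrite pow_stirling2 /touchard mulr_sumr; apply: ler_sum => j _.
rewrite mulrnAr lerMn2r; apply/orP; right; rewrite /shifted_term; case: leqP => jk.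
  rewrite -{1}(subnKC jk) exprD -mulrA mulrC ler_wpM2r ?exprn_ge0//.
  exact: exp_term_le.
by rewrite mulr_ge0// ?expR_ge0// exprn_ge0.
Qed.

Lemma exp_sum_le a n : 0 <= a -> \sum_(i < n) a ^+ i / i`!%:R <= expR a.
Proof.
move=> a0; rewrite -(big_mkord xpredT (fun i => a ^+ i / i`!%:R)).
apply: (nondecreasing_cvgn_le (u_ := series (exp_coeff a))).
  by apply: nondecreasing_series => i _ _; exact: exp_coeff_ge0.
exact: is_cvg_series_exp_coeff.
Qed.

(** The half of Dobinski's formula that the upper bound needs, for partial sums:
    the terms [k < M + n] contain, for each [j <= n], the first [M] terms of the
    exponential series shifted by [j]. *)
Lemma touchard_partial a n M : 0 <= a ->
  (\sum_(i < M) a ^+ i / i`!%:R) * touchard n a <=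
  \sum_(k < M + n) k%:R ^+ n * (a ^+ k / k`!%:R).
Proof.
move=> a0; under [leRHS]eq_bigr do rewrite pow_stirling2.
rewrite exchange_big /touchard mulr_sumr; apply: ler_sum => j _.
rewrite mulrnAr sumrMnl lerMn2r; apply/orP; right.
rewrite -(big_mkord xpredT (fun k => shifted_term a k j)) (big_cat_nat (n := j))//=; last first.
  by have := ltn_ord j; lia.
rewrite -[leLHS]add0r lerD//.
  by apply: sumr_ge0 => i _; rewrite /shifted_term; case: ifP => // _; rewrite divr_ge0 ?exprn_ge0.
rewrite -{2}[nat_of_ord j]add0n big_addn.
have -> : (M + n - j = M + (n - j))%N by have := ltn_ord j; lia.
rewrite [leRHS](big_cat_nat (n := M)) ?leq_addr//= -[leLHS]addr0 lerD//.
  rewrite big_mkord mulr_suml; apply: ler_sum => i _.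
  by rewrite /shifted_term leq_addl addnK exprD mulrAC.
by apply: sumr_ge0 => i _; rewrite /shifted_term; case: ifP => // _; rewrite divr_ge0 ?exprn_ge0.
Qed.

(** Chernoff's bound on the Poisson moments: [(r k)^n / n! <= exp (r k)] in each
    term of Dobinski's series, which then sums to [exp (a exp r)]. *)
Lemma touchard_le a r n : 0 <= a -> 0 < r ->
  touchard n a <= n`!%:R / r ^+ n * expR (a * (expR r - 1)).
Proof.
move=> a0 r0.
set B := n`!%:R / r ^+ n * expR (a * expR r).
have B0 : 0 < B by rewrite !mulr_gt0 ?invr_gt0 ?exprn_gt0 ?expR_gt0// ltr0n fact_gt0.
have partial M : (\sum_(i < M) a ^+ i / i`!%:R) * touchard n a <= B.
  apply: le_trans (touchard_partial _ _ a0) _.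
  apply: le_trans (_ : n`!%:R / r ^+ n * (\sum_(k < M + n) (a * expR r) ^+ k / k`!%:R) <= _).
    rewrite mulr_sumr; apply: ler_sum => k _.
    rewrite exprMn.
    have -> : n`!%:R / r ^+ n * (a ^+ k * expR r ^+ k / k`!%:R) =
        (n`!%:R / r ^+ n * expR r ^+ k) * (a ^+ k / k`!%:R) by ring.
    rewrite ler_wpM2r ?divr_ge0 ?exprn_ge0//.
    have := exp_term_le n (mulr_ge0 (ler0n R k) (ltW r0)).
    rewrite expRM_natl ler_pdivrMr ?ltr0n ?fact_gt0// exprMn.
    by rewrite -ler_pdivlMr ?exprn_gt0// [expR r ^+ k * _]mulrC mulrAC.
  rewrite ler_wpM2l ?divr_ge0 ?exprn_ge0 ?(ltW r0)//.
  by rewrite exp_sum_le// mulr_ge0// expR_ge0.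
have [->|T0] := eqVneq (touchard n a) 0.
  by rewrite mulr_ge0 ?expR_ge0// divr_ge0// exprn_ge0// ltW.
have Tp : 0 < touchard n a by rewrite lt_def T0 touchard_ge0.
have : expR a <= B / touchard n a.
  apply: limr_le; first exact: is_cvg_series_exp_coeff.
  by apply: nearW => M; rewrite ler_pdivlMr// /series/= big_mkord partial.
rewrite ler_pdivlMr// mulrBr mulr1 expRB mulrA ler_pdivlMr ?expR_gt0//.
by rewrite mulrC.
Qed.

End touchard_bounds.

(** * Comparison with n! / log^n (n + e) *)

Section asymptotics.
Variable R : realType.
Implicit Types (a q : R) (n : nat).
Local Notation e := (expR 1 : R).

Let e_ge2 : 2 <= e.
Proof. by have := @expR_ge1Dx R 1. Qed.

Lemma expR_log_ne n : expR (log_ne R n) = n%:R + e.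
Proof. by rewrite lnK// posrE ltr_wpDl ?expR_gt0. Qed.

Lemma log_ne_gt0 n : 0 < log_ne R n.
Proof.
rewrite ln_gt0// (lt_le_trans (_ : 1 < e))//; first by rewrite expR_gt1.
by rewrite lerDr.
Qed.

(** Convexity: on [0, x] the exponential lies below its chord.  Obtained by
    averaging the tangent at [s x] evaluated at [x] and at [0]. *)
Lemma expR_chord (s x : R) : 0 <= s <= 1 -> expR (s * x) <= 1 + s * (expR x - 1).
Proof.
move=> /andP[s0 s1].
have h1 : expR (s * x) * (1 + (1 - s) * x) <= expR x.
  have -> : expR x = expR (s * x) * expR ((1 - s) * x).
    by rewrite -expRD; congr expR; ring.
  by rewrite ler_wpM2l ?expR_ge0// expR_ge1Dx.
have h2 : expR (s * x) * (1 - s * x) <= 1.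
  rewrite -[leRHS]expR0 -(subrr (s * x)) expRD.
  by rewrite ler_wpM2l ?expR_ge0// expR_ge1Dx.
have -> : 1 + s * (expR x - 1) = s * expR x + (1 - s) by ring.
have -> : expR (s * x) = s * (expR (s * x) * (1 + (1 - s) * x)) +
  (1 - s) * (expR (s * x) * (1 - s * x)) by ring.
by rewrite lerD ?ler_wpM2l// -[leRHS]mulr1 ler_wpM2l ?subr_ge0.
Qed.

Lemma touchard0 a : touchard 0 a = 1.
Proof. by rewrite /touchard big_ord_recl big_ord0 /= addr0 expr0. Qed.

(** The parameter [r] of [touchard_le] is [log (n + e)] for large [C] and
    [C log (n + e)] for small [C].  In the first case [a (exp r - 1)] is at most
    [a e n] with [a <= 1 / C]; in the second, [expR_chord] bounds it by
    [a C e n] with [a C <= 1].  The constant [exp (1 + e)] covers both. *)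
Lemma touchard_upper (C : R) n : 0 < C ->
  C ^+ n * touchard n (1 / (C * (1 + C))) <=
  (C + expR (1 + e)) ^+ n * (n`!%:R / log_ne R n ^+ n).
Proof.
move=> C0; move Ea : (1 / _) => a.
have C1 : 0 < 1 + C by rewrite ltr_wpDl.
have a0 : 0 < a by rewrite -Ea divr_gt0 ?mulr_gt0.
case: n => [|n]; first by rewrite touchard0 !expr0 divr1 mulr1.
set L := log_ne _ _.
have L0 : 0 < L by exact: log_ne_gt0.
have eL : expR L - 1 <= e * n.+1%:R.
  have : 0 <= (e - 1) * n%:R by rewrite mulr_ge0// subr_ge0 (le_trans _ e_ge2)// ler1n.
  by rewrite expR_log_ne -natr1; lra.
have K0 : 0 < expR (1 + e) by exact: expR_gt0.
have fL0 : 0 <= n.+1`!%:R / L ^+ n.+1 by rewrite divr_ge0// exprn_ge0// ltW.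
have [Cge1|Clt1] := leP 1 C.
- apply: le_trans (_ : (C * expR (a * e)) ^+ n.+1 * (n.+1`!%:R / L ^+ n.+1) <= _).
    rewrite exprMn -mulrA ler_wpM2l ?exprn_ge0 ?(ltW C0)//.
    apply: le_trans (touchard_le _ (ltW a0) L0) _.
    rewrite mulrC ler_wpM2r// -expRM_natr ler_expR -[leRHS]mulrA.
    by rewrite ler_wpM2l ?(ltW a0).
  rewrite ler_wpM2r// ler_pXn2r// ?nnegrE ?addr_ge0 ?mulr_ge0 ?expR_ge0 ?(ltW C0)//.
  have Ca : C * a <= 1.
    by rewrite -Ea mul1r invfM mulrA divff ?gt_eqF// mul1r invf_le1// lerDl ltW.
  have a1 : a <= 1 by apply: le_trans Ca; rewrite ler_peMl ?(ltW a0).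
  have h : expR (a * e) <= 1 + a * e * expR (a * e).
    have : expR (a * e) * (1 - a * e) <= 1.
      rewrite -[leRHS]expR0 -(subrr (a * e)) expRD.
      by rewrite ler_wpM2l ?expR_ge0// expR_ge1Dx.
    by lra.
  apply: le_trans (_ : C * (1 + a * e * expR (a * e)) <= _).
    by rewrite ler_wpM2l// ltW.
  rewrite mulrDr mulr1 lerD2l expRD.
  have -> : C * (a * e * expR (a * e)) = (C * a) * (e * expR (a * e)) by ring.
  rewrite -[leRHS]mul1r ler_pM ?mulr_ge0 ?expR_ge0 ?(ltW C0) ?(ltW a0)//.
  by rewrite ler_wpM2l ?expR_ge0// ler_expR ler_piMl ?expR_ge0.
- apply: le_trans (_ : (expR e) ^+ n.+1 * (n.+1`!%:R / L ^+ n.+1) <= _); last first.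
    rewrite ler_wpM2r// ler_pXn2r// ?nnegrE ?addr_ge0 ?expR_ge0 ?(ltW C0)//.
    by rewrite (le_trans (_ : _ <= expR (1 + e)))// ?ler_expR ?lerDr ?lerDl ?(ltW C0).
  have CL0 : 0 < C * L by rewrite mulr_gt0.
  apply: le_trans (_ : C ^+ n.+1 * (n.+1`!%:R / (C * L) ^+ n.+1 * expR (a * (expR (C * L) - 1))) <= _).
    by rewrite ler_wpM2l ?exprn_ge0 ?(ltW C0)// touchard_le// ltW.
  have -> : C ^+ n.+1 * (n.+1`!%:R / (C * L) ^+ n.+1 * expR (a * (expR (C * L) - 1)))
     = expR (a * (expR (C * L) - 1)) * (n.+1`!%:R / L ^+ n.+1).
    rewrite exprMn; field.
    by rewrite !expf_neq0 ?gt_eqF.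
  rewrite ler_wpM2r// -expRM_natr ler_expR.
  apply: le_trans (_ : a * (C * (e * n.+1%:R)) <= _).
    rewrite ler_wpM2l ?(ltW a0)// lerBlDl.
    apply: le_trans (expR_chord _ _) _; first by rewrite (ltW C0) ltW.
    by rewrite lerD2l ler_wpM2l ?(ltW C0).
  rewrite [leLHS]mulrA -[leRHS]mul1r ler_wpM2r// ?mulr_ge0 ?expR_ge0//.
  have -> : a * C = (1 + C)^-1.
    by rewrite -Ea mul1r invfM mulrAC mulVf ?gt_eqF// mul1r.
  by rewrite invf_le1// lerDl ltW.
Qed.

(** Stirling's upper bound up to a polynomial factor; the induction step is
    [e n^(n+1) <= (n+1)^(n+1)]. *)
Lemma fact_expR_le n : (0 < n)%N ->
  n`!%:R * expR n%:R <= e * n%:R ^+ n.+1.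
Proof.
elim: n => // -[_ _|n IH _]; first by rewrite mul1r expr1n mulr1.
set m := n.+1 in IH *.
have h : e * m%:R ^+ m.+1 <= m.+1%:R ^+ m.+1.
  have le1 : m%:R <= m.+1%:R * expR (- m.+1%:R^-1) :> R.
    apply: le_trans (_ : m.+1%:R * (1 - m.+1%:R^-1) <= _); last first.
      by rewrite ler_wpM2l// expR_ge1Dx.
    by rewrite mulrBr mulr1 divff ?pnatr_eq0// -natr1 addrK.
  have : m%:R ^+ m.+1 <= (m.+1%:R * expR (- m.+1%:R^-1)) ^+ m.+1 :> R.
    by rewrite lerXn2r ?nnegrE// mulr_ge0 ?expR_ge0.
  rewrite exprMn -expRM_natr mulNr mulVf ?pnatr_eq0// expRN.
  by rewrite ler_pdivlMr ?expR_gt0// mulrC.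
have -> : m.+1`!%:R * expR m.+1%:R = m.+1%:R * e * (m`!%:R * expR m%:R).
  by rewrite factS natrM -[in expR _]natr1 expRD; ring.
apply: le_trans (_ : m.+1%:R * e * (e * m%:R ^+ m.+1) <= _).
  by rewrite ler_wpM2l ?mulr_ge0 ?expR_ge0// IH.
have -> : m.+1%:R * e * (e * m%:R ^+ m.+1) =
  e * (m.+1%:R * (e * m%:R ^+ m.+1)) by ring.
by rewrite [in leRHS]exprS !ler_wpM2l ?expR_ge0.
Qed.

(** Take [k] the integer part of [exp m] and [n = k m], so that
    [log (n + e) >= m = n / k] and [k! <= k^k <= exp n].  The [k]-th term of
    Dobinski's series is then at least [(n / m)^n a^k exp (- n)], while [n!] is
    about [n^n exp (- n)]: the quotient with [n! (q / m)^n] is of order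
    [(a q^(- m))^k / n], which is large once [m] is. *)
Lemma touchard_lower al q B : 0 < q < 1 ->
  exists n, B <= log_ne R n /\
    n`!%:R * (q / log_ne R n) ^+ n < touchard n (expR al).
Proof.
move=> /andP[q0 q1]; set a := expR al.
have a0 : 0 < a by exact: expR_gt0.
set s := - ln q.
have s0 : 0 < s by rewrite oppr_gt0 ln_lt0// q0.
have qE : q = expR (- s) by rewrite opprK lnK.
(* [m] must exceed [B], and make [q^(- m) a = exp (s m + al)] at least
   [exp (3 + a)]: one factor [exp k] absorbs [k], a second one absorbs
   [m <= k], and the rest absorbs [exp (1 + a)]. *)
set X := `|B| + `|(3 + a - al) / s|.
set m := (Num.truncn X).+1.
have Xm : X < m%:R by exact: truncnS_gt.
have Bm : B <= m%:R.
  by apply: ltW; apply: le_lt_trans Xm; rewrite (le_trans (ler_norm _))// lerDl.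
have sm : 3 + a - al <= s * m%:R.
  rewrite mulrC -ler_pdivrMr//; apply: ltW; apply: le_lt_trans Xm.
  by rewrite (le_trans (ler_norm _))// lerDr.
set k := Num.truncn (expR m%:R : R).
have k1 : expR m%:R < k.+1%:R :> R by exact: truncnS_gt.
have k2 : k%:R <= expR m%:R :> R by rewrite truncn_le// expR_ge0.
have mk : (m < k.+1)%N.
  rewrite -(ltr_nat R); apply: le_lt_trans k1.
  by apply: le_trans (expR_ge1Dx _); rewrite lerDr.
have kp : (0 < k)%N by exact: leq_trans (ltnSE mk).
set n := (k * m)%N.
have np : (0 < n)%N by rewrite muln_gt0 kp.
exists n.
have mL : m%:R <= log_ne R n.
  rewrite -ler_expR expR_log_ne (le_trans (ltW k1))// -natr1 lerD//.
    by rewrite ler_nat leq_pmulr.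
  by apply: le_trans e_ge2; rewrite ler1n.
split; first exact: le_trans Bm mL.
have L0 := log_ne_gt0 n.
have mp : 0 < m%:R :> R by rewrite ltr0n.
apply: le_lt_trans (_ : n`!%:R * (q / m%:R) ^+ n < _).
  rewrite ler_wpM2l// lerXn2r ?nnegrE ?divr_ge0 ?(ltW q0) ?(ltW L0)//.
  by rewrite ler_wpM2l ?(ltW q0)// lef_pV2.
rewrite -(ltr_pM2l (expR_gt0 a)).
apply: lt_le_trans (touchard_ge n k (ltW a0)).
rewrite mulrA ltr_pdivlMr ?ltr0n ?fact_gt0//.
have fk : k`!%:R <= expR n%:R :> R.
  apply: le_trans (_ : k%:R ^+ k <= _).
    rewrite -natrX ler_nat fact_prod big_add1 big_mkord.
    apply: leq_trans (_ : \prod_(i < k) k <= _)%N; last first.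
      by rewrite prod_nat_const card_ord.
    by apply: leq_prod => i _; exact: ltn_ord.
  by rewrite natrM mulrC expRM_natr lerXn2r ?nnegrE ?expR_ge0.
have qn : q ^+ n * expR (1 + a) * n%:R < a ^+ k.
  rewrite /a -expRM_natl qE -expRM_natl -/a.
  apply: lt_le_trans (_ : expR (- (n%:R * s)) * expR (1 + a) * (expR k%:R * expR k%:R) <= _).
    have e1 : expR (n%:R * - s) * expR (1 + a) > 0 by rewrite mulr_gt0 ?expR_gt0.
    rewrite mulrN in e1 *; rewrite ltr_pM2l// natrM.
    have kek : k%:R < expR k%:R :> R by apply: lt_le_trans (expR_ge1Dx _); rewrite ltrDr.
    apply: le_lt_trans (_ : k%:R * k%:R < _); last by rewrite ltr_pM.
    by rewrite ler_wpM2l// ler_nat.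
  rewrite -!expRD ler_expR natrM.
  have : k%:R * (3 + a - al) <= k%:R * (s * m%:R) by rewrite ler_wpM2l.
  have : (1 + a) <= k%:R * (1 + a) by rewrite ler_peMl ?ler1n// addr_ge0// ltW.
  lra.
apply: le_lt_trans (_ : k%:R ^+ n * (q ^+ n * expR (1 + a) * n%:R) < _); last first.
  by rewrite ltr_pM2l// exprn_gt0// ltr0n.
have ff := fact_expR_le np.
rewrite exprMn exprVn.
have nk : n%:R ^+ n / m%:R ^+ n = k%:R ^+ n :> R.
  by rewrite -expr_div_n natrM mulfK// gt_eqF.
rewrite -nk.
have -> : n%:R ^+ n / m%:R ^+ n * (q ^+ n * expR (1 + a) * n%:R) =
  expR a * (q ^+ n / m%:R ^+ n) * (e * n%:R ^+ n.+1).
  rewrite expRD exprS.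
  move: e (expR a) (n%:R : R) (n%:R ^+ n) (m%:R ^+ n) (q ^+ n) => *; ring.
apply: le_trans (_ : expR a * (q ^+ n / m%:R ^+ n) * (n`!%:R * expR n%:R) <= _).
  apply: le_trans (_ : expR a * (q ^+ n / m%:R ^+ n) * (n`!%:R * k`!%:R) <= _).
    rewrite le_eqVlt; apply/orP; left; apply/eqP.
    by move: (q ^+ n) (m%:R ^+ n) (n`!%:R : R) (k`!%:R : R) (expR a) => *; ring.
  by rewrite !ler_wpM2l ?mulr_ge0 ?expR_ge0 ?invr_ge0 ?exprn_ge0 ?(ltW q0) ?(ltW mp).
by rewrite !ler_wpM2l ?mulr_ge0 ?expR_ge0 ?invr_ge0 ?exprn_ge0 ?(ltW q0) ?(ltW mp).
Qed.

End asymptotics.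

(** * The equation and its solution *)

Section construction.
Variable R : realType.

Lemma smooth_is_derive (F : nat -> R -> Rcomplex R) :
  (forall n (x : R), is_derive x 1 (F n) (F n.+1 x)) -> smooth (F 0%N).
Proof.
by move=> dF n x; rewrite derive1n_is_derive//; case: (dF n x).
Qed.

(** The [n]-th derivative of [wave]; the coefficients of the equation are [W],
    the case [n = 1], and [V], the case [n = 2]. *)
Definition wave_deriv (al C : R) n x : Rcomplex R := rect 0 C ^+ n * wave al C x.

Lemma is_derive_wave_deriv (al C : R) n (x : R) :
  is_derive x 1 (wave_deriv al C n) (wave_deriv al C n.+1 x).
Proof.
rewrite /wave_deriv exprSr -mulrA.
by apply: is_derive_mull; exact: is_derive_wave.
Qed.

Lemma sup_norm_wave_deriv (al C : R) n : 0 < C ->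
  (sup_norm (wave_deriv al C n) <= (C ^+ n * expR al)%:E)%E.
Proof.
move=> C0; apply: ge_ereal_sup => _ [x _ <-].
by rewrite lee_fin Rcomplex_normM Rcomplex_normX norm_rect_im// norm_wave.
Qed.

Lemma mode_sum0 (al C : R) : mode al C 0 = mode_sum al C 0.
Proof.
apply/funext => x.
by rewrite /mode_sum big_ord_recl big_ord0 addr0 expr0 mul1r mulr1n.
Qed.

(** With [w] the wave and [k = i C], both sides are [k^2 (w + w^2)] times
    [mode 0]. *)
Lemma mode_ode (al C x : R) : mode_sum al C 2 x =
  wave_deriv al C 1 x * mode_sum al C 1 x + wave_deriv al C 2 x * mode al C 0 x.
Proof.
rewrite /mode_sum /wave_deriv !big_ord_recl !big_ord0 /= !mulr0n !add0r !addr0.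
rewrite !mulr1n !modeS !expr1; ring.
Qed.

End construction.

Unset Implicit Arguments.

Theorem proposition2p6 (R : realType) :
  exists (W V u : R -> R -> Rcomplex R) (K : R),
    0 < K /\
    (forall C0 : R, 0 < C0 ->
      [/\ smooth (W C0), smooth (V C0) & smooth (u C0)] /\
      (forall n : nat,
         (sup_norm ((W C0)^`(n)) + sup_norm ((V C0)^`(n)) <= (C0 ^+ n)%:E)%E) /\
      (forall x : R,
         (u C0)^`(2) x = W C0 x * ((u C0)^`())%classic x + V C0 x * u C0 x) /\
      Linfty_norm (u C0) = 1%E /\
      (forall kappa : R, 1 < kappa -> forall n : nat,
         (Linfty_norm ((u C0)^`(n)) <=
          ((kappa * C0 + K * (1 / ln kappa + 1)) ^+ n *
           (n`!%:R / log_ne R n ^+ n))%:E)%E)) /\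
    (forall C lambda C0 : R, 0 < C -> 1 < lambda -> 0 < C0 ->
      ~ (forall n : nat,
           (Linfty_norm ((u C0)^`(n)) <=
            (C ^+ n * n`!%:R / (log_ne R n `^ (lambda * n%:R)))%:E)%E)) /\
    (forall kappa C : R, 0 < kappa < 1 -> 0 < C ->
      exists M : R, forall C0 : R, 0 < C0 -> M < C0 ->
      ~ (forall n : nat,
           (Linfty_norm ((u C0)^`(n)) <=
            ((kappa * C0 + C) ^+ n *
             (n`!%:R / log_ne R n ^+ n))%:E)%E)).
Proof.
pose al (C0 : R) := ln (1 / (C0 * (1 + C0))).
have alE C0 : 0 < C0 -> expR (al C0) = 1 / (C0 * (1 + C0)).
  by move=> C0p; rewrite lnK// posrE divr_gt0// mulr_gt0// ltr_wpDl.
have uE C0 n : (mode (al C0) C0 0)^`(n) = mode_sum (al C0) C0 n.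
  rewrite mode_sum0; apply: derive1n_is_derive => m x.
  exact: is_derive_mode_sum.
have WE C0 i n : (wave_deriv (al C0) C0 i)^`(n) = wave_deriv (al C0) C0 (n + i).
  apply: (derive1n_is_derive (F := fun n => wave_deriv (al C0) C0 (n + i))) => m x.
  exact: is_derive_wave_deriv.
exists (fun C0 => wave_deriv (al C0) C0 1), (fun C0 => wave_deriv (al C0) C0 2).
exists (fun C0 => mode (al C0) C0 0), (expR (1 + expR 1)).
split; first exact: expR_gt0.
split; last split.
- move=> C0 C0p; split; first split.
  + apply: (smooth_is_derive (F := fun n => wave_deriv (al C0) C0 (n + 1))) => m x.
    exact: is_derive_wave_deriv.
  + apply: (smooth_is_derive (F := fun n => wave_deriv (al C0) C0 (n + 2))) => m x.
    exact: is_derive_wave_deriv.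
  + rewrite mode_sum0; apply: smooth_is_derive => m x.
    exact: is_derive_mode_sum.
  split=> [n|].
    rewrite !WE; apply: le_trans (leeD (sup_norm_wave_deriv _ _ C0p)
                                       (sup_norm_wave_deriv _ _ C0p)) _.
    rewrite -EFinD lee_fin alE// le_eqVlt; apply/orP; left; apply/eqP.
    rewrite !exprD; field.
    by rewrite !gt_eqF// ltr_wpDl.
  split=> [x|].
    by rewrite -derive1n1 !uE mode_ode.
  split.
    by rewrite mode_sum0 Linfty_mode_sum// touchard0 mulr1.
  move=> kappa k1 n; rewrite uE Linfty_mode_sum// lee_fin alE//.
  apply: le_trans (touchard_upper n C0p) _.
  have lk : 0 < ln kappa by exact: ln_gt0.
  rewrite ler_wpM2r ?divr_ge0 ?exprn_ge0 ?(ltW (log_ne_gt0 _ _))//.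
  have K0 : 0 < expR (1 + expR 1) :> R by exact: expR_gt0.
  have leK : C0 + expR (1 + expR 1) <=
      kappa * C0 + expR (1 + expR 1) * (1 / ln kappa + 1).
    rewrite lerD//; first by rewrite ler_peMl ?(ltW C0p)// ltW.
    by rewrite ler_peMr ?(ltW K0)// lerDr divr_ge0// ltW.
  have K1 : 0 <= C0 + expR (1 + expR 1) by rewrite addr_ge0// ltW.
  by rewrite lerXn2r ?nnegrE// (le_trans K1).
- move=> C lambda C0 Cp l1 C0p H.
  have q01 : 0 < (1 / 2 : R) < 1 by apply/andP; split; lra.
  have [n [BL]] := touchard_lower (al C0) ((2 * C / C0) `^ (lambda - 1)^-1) q01.
  have := H n; rewrite uE Linfty_mode_sum// lee_fin.
  set T := touchard _ _; set L := log_ne _ _ in BL *.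
  have L0 : 0 < L by exact: log_ne_gt0.
  have X0 : 0 < 2 * C / C0 by rewrite divr_gt0 ?mulr_gt0.
  have l10 : 0 < lambda - 1 by rewrite subr_gt0.
  (* [L >= B] was arranged so that [L^lambda] beats [(2 C / C0) L]. *)
  have BL' : 2 * C / C0 <= L `^ (lambda - 1).
    have -> : 2 * C / C0 = ((2 * C / C0) `^ (lambda - 1)^-1) `^ (lambda - 1).
      by rewrite -powRrM mulVf ?lt0r_neq0// powRr1// ltW.
    by rewrite ge0_ler_powR ?nnegrE ?powR_ge0 ?(ltW L0) ?(ltW l10).
  rewrite powRrM powR_mulrn ?powR_ge0// -mulr_powRB1 ?(ltW L0)//; last lra.
  set P := L `^ _ in BL' *.
  have P0 : 0 < P by apply: lt_le_trans BL'.
  move=> up low.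
  have f0 : 0 < n`!%:R :> R by rewrite ltr0n fact_gt0.
  have le1 : C / (L * P) <= C0 * (1 / 2 / L).
    rewrite ler_pdivrMr ?mulr_gt0//.
    have -> : C0 * (1 / 2 / L) * (L * P) = (P * C0) / 2.
      by field; rewrite gt_eqF.
    by rewrite ler_pdivlMr// mulrC -ler_pdivrMr.
  have : C0 ^+ n * (n`!%:R * (1 / 2 / L) ^+ n) < C0 ^+ n * T.
    by rewrite ltr_pM2l ?exprn_gt0.
  apply/negP; rewrite -leNgt; apply: le_trans up _.
  rewrite mulrAC -expr_div_n [leRHS]mulrCA -exprMn mulrC ler_pM2l//.
  have n1 : 0 <= C / (L * P) by rewrite ltW// divr_gt0 ?mulr_gt0.
  by rewrite lerXn2r ?nnegrE// (le_trans n1).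
- move=> kappa C /andP[k0 k1] Cp; exists (C / (1 - kappa)) => C0 C0p MC H.
  have q01 : 0 < kappa + C / C0 < 1.
    rewrite addr_gt0 ?divr_gt0//= -ltrBrDl ltr_pdivrMr// mulrC.
    by rewrite -ltr_pdivrMr ?subr_gt0.
  have [n [_ low]] := touchard_lower (al C0) 0 q01.
  have := H n; rewrite uE Linfty_mode_sum// lee_fin leNgt => /negP; apply.
  have -> : kappa * C0 + C = C0 * (kappa + C / C0) by field; rewrite gt_eqF.
  rewrite exprMn -mulrA ltr_pM2l ?exprn_gt0//.
  by apply: le_lt_trans low; rewrite expr_div_n mulrCA.
Qed.
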